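(* Let $\$=\langle 1,c_2,c_3,c_4\rangle$ be a coin system, i.e. natural numbers $1<c_2<c_3<c_4$. Then $\$$ is non-canonical if and only if at least one of the following conditions holds: (1) the coin system $\langle 1,c_2,c_3\rangle$ is non-canonical; (2) there is a natural number $k$ with $k\cdot c_3<c_4<(k+1)\cdot c_3$ and $|\mathrm{GRD}_{\$}((k+1)\cdot c_3)|>k+1$.
   Context: A coin system is a tuple $\$=\langle c_1,c_2,\dots,c_m\rangle$ of natural numbers with $1=c_1<c_2<\cdots<c_m$. A representation of a natural number $x$ under $\$$ is a tuple $(\alpha_1,\dots,\alpha_m)$ of natural numbers with $\sum_i \alpha_i c_i=x$; its size is $\sum_i\alpha_i$. The greedy representation $\mathrm{GRD}_{\$}(x)$ is the unique representation satisfying $\sum_{j=1}^{i-1}\alpha_jc_j<c_i$ for all $2\le i\le m$ (obtained by repeatedly taking the largest coin not exceeding the remaining amount), and $|\mathrm{GRD}_{\$}(x)|$ is its size. $\mathrm{OPT}_{\$}(x)$ denotes a representation of $x$ of minimum size, with size $|\mathrm{OPT}_{\$}(x)|$. The system $\$$ is canonical if $|\mathrm{GRD}_{\$}(x)|=|\mathrm{OPT}_{\$}(x)|$ for all natural numbers $x$; otherwise it is non-canonical, and any $x$ with $|\mathrm{GRD}_{\$}(x)|>|\mathrm{OPT}_{\$}(x)|$ is called a counterexample of $\$$. *)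

(* Defs.v *)
From mathcomp Require Import all_boot.
From mathcomp Require Import zify.

Set Implicit Arguments.
Unset Strict Implicit.
Unset Printing Implicit Defensive.

(* The system <c_1, ..., c_m> is the sequence [:: c_1; ...; c_m], so indices
   are shifted: c_i is nth 0 s i.-1. *)
Definition coin_system (s : seq nat) : bool := (head 0 s == 1) && sorted ltn s.

Definition rep_value (s a : seq nat) : nat :=
  \sum_(i < size s) nth 0 a i * nth 0 s i.

Definition rep_size (a : seq nat) : nat := sumn a.

Definition representation (s : seq nat) (x : nat) (a : seq nat) : bool :=
  (size a == size s) && (rep_value s a == x).

(* Coins are stored in increasing order: the multiplicities of the coins of the
   tail (the larger ones) are computed first, and then as many copies of the
   head as possible are taken from what remains of x. *)
Fixpoint GRD (s : seq nat) (x : nat) : seq nat :=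
  if s is c :: s' then
    let a := GRD s' x in (x - rep_value s' a) %/ c :: a
  else [::].

Definition is_OPT (s : seq nat) (x : nat) (a : seq nat) : Prop :=
  representation s x a /\
  forall b, representation s x b -> rep_size a <= rep_size b.

Definition canonical (s : seq nat) : Prop :=
  forall x a, is_OPT s x a -> rep_size (GRD s x) = rep_size a.

Definition greedy (s a : seq nat) : Prop :=
  forall i, 0 < i < size s ->
    \sum_(j < i) nth 0 a j * nth 0 s j < nth 0 s i.

Lemma rep_value_cons c s d a :
  rep_value (c :: s) (d :: a) = d * c + rep_value s a.
Proof. by rewrite /rep_value /= big_ord_recl. Qed.

Lemma size_GRD s x : size (GRD s x) = size s.
Proof. by elim: s => //= c s ->. Qed.

Lemma GRD_value_le s x : rep_value s (GRD s x) <= x.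
Proof.
elim: s => [|c s IH] /=; first by rewrite /rep_value big_ord0.
rewrite rep_value_cons; have := leq_divM (x - rep_value s (GRD s x)) c.
by move: IH; lia.
Qed.

Lemma GRD_rem s x :
  0 < head 0 s -> x - rep_value s (GRD s x) < head 0 s.
Proof.
case: s => //= c s c0; rewrite rep_value_cons.
have H := divn_eq (x - rep_value s (GRD s x)) c.
have := ltn_pmod (x - rep_value s (GRD s x)) c0.
by have := GRD_value_le s x; lia.
Qed.

Lemma rep_value_split s a i : i <= size s -> i <= size a ->
  rep_value s a =
  \sum_(j < i) nth 0 a j * nth 0 s j + rep_value (drop i s) (drop i a).
Proof.
elim: i s a => [|i IH] s a; first by rewrite big_ord0 !drop0.
case: s => // c s; case: a => // d a; rewrite /= !ltnS => hs ha.
by rewrite rep_value_cons (IH s a hs ha) big_ord_recl /= addnA.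
Qed.

Lemma drop_GRD i s x : drop i (GRD s x) = GRD (drop i s) x.
Proof. by elim: s i => [|c s IH] [|i] //=. Qed.

Lemma coin_gt0 s i : coin_system s -> i < size s -> 0 < nth 0 s i.
Proof.
case: s => // c s /andP[/eqP /= -> p]; case: i => // i hi.
have : all (ltn 1) s by apply: order_path_min p; exact: ltn_trans.
move=> /allP /(_ _ (mem_nth 0 hi)).
exact: ltnW.
Qed.

Lemma GRD_representation s x : coin_system s -> representation s x (GRD s x).
Proof.
move=> cs; rewrite /representation size_GRD eqxx /=.
have h1 : head 0 s = 1 by case/andP: cs => /eqP.
have := @GRD_rem s x; rewrite h1 => /(_ isT).
by have := GRD_value_le s x; lia.
Qed.

Lemma GRD_greedy s x : coin_system s -> greedy s (GRD s x).
Proof.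
move=> cs i /andP[_ hi].
have /andP[_ /eqP e] := GRD_representation x cs.
have := rep_value_split (ltnW hi) (a := GRD s x).
rewrite size_GRD => /(_ (ltnW hi)); rewrite e drop_GRD => e2.
have := @GRD_rem (drop i s) x.
rewrite -nth0 nth_drop addn0 => /(_ (coin_gt0 cs hi)).
by move: e2; lia.
Qed.

(* GRD s x is the unique representation of x satisfying the greedy condition. *)
Lemma GRD_unique s x a :
  coin_system s -> representation s x a -> greedy s a -> a = GRD s x.
Proof.
move=> cs /andP[/eqP sa /eqP va] ga.
suff H k : k <= size s -> drop (size s - k) a = GRD (drop (size s - k) s) x.
  by have := H _ (leqnn _); rewrite subnn !drop0.
elim: k => [_|k IH hk]; first by rewrite subn0 drop_size -sa drop_size.
set i := size s - k.+1.
have hi : i < size s by rewrite /i; lia.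
have iS : i.+1 = size s - k by rewrite /i; lia.
rewrite (drop_nth 0 hi) (drop_nth 0 (s := a)) ?sa //= iS -(IH (ltnW hk)) -iS.
congr (_ :: _).
have := rep_value_split (s := s) (a := a) (i := i.+1); rewrite sa va.
move=> /(_ hi hi); rewrite big_ord_recr /= => ->; rewrite addnK.
rewrite addnC divnMDl ?(coin_gt0 cs) // divn_small ?addn0 //.
case: {iS} i hi => [|i] hi; last by apply: ga.
by rewrite big_ord0 (coin_gt0 cs).
Qed.

Lemma OPT_exists s x : coin_system s -> exists a, is_OPT s x a.
Proof.
move=> cs; have := GRD_representation x cs; move: (GRD s x) => a.
have [n] := ubnP (rep_size a); elim: n a => // n IH a le ra.
pose P b := representation s x b && (rep_size b < rep_size a).
have [[b /andP[rb lb]]|nob] : (exists b, P b) \/ ~ (exists b, P b).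
  have bnd b : rep_size b < rep_size a -> all (fun d => d < rep_size a) b.
    move=> lb; apply/allP => d db; apply: leq_ltn_trans lb.
    by rewrite /rep_size sumnE (big_rem d) //= leq_addr.
  case: (pickP (fun t : (size s).-tuple 'I_(rep_size a) =>
                  P [seq nat_of_ord j | j <- t])) => [t Pt|no].
    by left; exists [seq nat_of_ord j | j <- t].
  right=> -[b /[dup] Pb /andP[/andP[/eqP sb _] /[dup] lb /bnd/allP ab]].
  have a0 : 0 < rep_size a by apply: leq_ltn_trans lb.
  pose t := [seq (insubd (Ordinal a0) d : 'I_(rep_size a)) | d <- b].
  have st : size t == size s by rewrite size_map sb.
  have := no (Tuple st); rewrite /= -map_comp.
  rewrite (_ : map _ b = b) ?Pb //.
  rewrite -[RHS]map_id; apply/eq_in_map => d /ab hd /=.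
  by rewrite val_insubd hd.
- by apply: (IH b) => //; apply: leq_trans lb _.
- exists a; split=> // b rb; rewrite leqNgt; apply/negP => lb.
  by apply: nob; exists b; rewrite /P rb.
Qed.

(* Main.v *)
Require Import Defs.
From mathcomp Require Import all_boot.
From mathcomp Require Import zify.

Set Implicit Arguments.
Unset Strict Implicit.
Unset Printing Implicit Defensive.

(** Write g and G for the greedy sizes of a canonical system with largest coin b
    and of its extension by c > b.  If c <= m * b and g (m * b - c) < m, then
    subadditivity of g gives
      m + g (y - c) = g (y + (m * b - c)) <= g y + g (m * b - c) < g y + m,
    so taking one coin c never costs anything, G <= g, and the extension is
    canonical.  When moreover m * b < c + b this sufficient condition is also
    necessary, as m * b is then a counterexample if it fails.  Applied to
    <1, c2, c3> and c4 this one-point criterion gives condition (2).  Applied to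
    <1, c2> and c3 it shows that a non-canonical <1, c2, c3> has m * c2 = c3 + r
    with m <= r < c2, and then m * c2, c2 + c3 or 2 * c3 is a counterexample
    of <1, c2, c3, c4>, whatever c4 is. *)

Notation grd_size s x := (rep_size (GRD s x)).

Lemma rep_value_rcons s c a d : size a = size s ->
  rep_value (rcons s c) (rcons a d) = rep_value s a + d * c.
Proof.
elim: s a => [|e s IH] [|f a] //= => [_|[sa]].
  by rewrite /rep_value /= big_ord1 big_ord0.
by rewrite !rep_value_cons IH // addnA.
Qed.

Lemma GRD_rcons s c x :
  GRD (rcons s c) x = rcons (GRD s (x %% c)) (x %/ c).
Proof.
elim: s => [|e s IH] /=; first by rewrite /rep_value big_ord0 subn0.
rewrite IH rep_value_rcons ?size_GRD //.
by rewrite {1}(divn_eq x c) addnC subnDr.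
Qed.

Lemma grd_size_rcons s c n x : x < c ->
  grd_size (rcons s c) (n * c + x) = n + grd_size s x.
Proof.
move=> xc; have c0 : 0 < c by apply: leq_ltn_trans xc.
rewrite GRD_rcons modnMDl divnMDl // (modn_small xc) (divn_small xc) addn0.
by rewrite /rep_size sumn_rcons addnC.
Qed.

Lemma grd_size_rconsD s c n x : 0 < c ->
  grd_size (rcons s c) (n * c + x) = n + grd_size (rcons s c) x.
Proof.
move=> c0; rewrite {1 2}(divn_eq x c) addnA -mulnDl.
by rewrite !grd_size_rcons ?ltn_pmod // addnA.
Qed.

(** This form needs no minimal representation: any tuple of coefficients can be tested against
    greedy directly. *)
Lemma canonicalP s : coin_system s ->
  canonical s <->
  forall a, size a = size s -> grd_size s (rep_value s a) <= rep_size a.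
Proof.
move=> cs; split=> [can a sa | le x a [/andP[/eqP sa /eqP <-] opt]].
  have [o oP] := OPT_exists (rep_value s a) cs.
  by rewrite (can _ _ oP); apply: oP.2; rewrite /representation sa !eqxx.
by apply/eqP; rewrite eqn_leq le // opt // GRD_representation.
Qed.

(** The coordinatewise sum of the two greedy representations represents [x + y], so canonicity
    bounds the greedy size by its size. *)
Lemma grd_size_subadditive s x y : coin_system s -> canonical s ->
  grd_size s (x + y) <= grd_size s x + grd_size s y.
Proof.
move=> cs /(canonicalP cs) le.
have /andP[_ /eqP ex] := GRD_representation x cs.
have /andP[_ /eqP ey] := GRD_representation y cs.
pose a := mkseq (fun i => nth 0 (GRD s x) i + nth 0 (GRD s y) i) (size s).
have := le a (size_mkseq _ _).
have -> : rep_value s a = x + y.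
  rewrite -[in RHS]ex -[in RHS]ey /rep_value -big_split /=.
  by apply: eq_bigr => i _; rewrite nth_mkseq // mulnDl.
suff -> : rep_size a = grd_size s x + grd_size s y by [].
have sumnE_nth t : size t = size s -> sumn t = \sum_(i < size s) nth 0 t i.
  by move=> <-; rewrite sumnE (big_nth 0) big_mkord.
rewrite /rep_size !sumnE_nth ?size_mkseq ?size_GRD // -big_split /=.
by apply: eq_bigr => i _; rewrite nth_mkseq.
Qed.

Lemma coin_system_belast s b c :
  coin_system (rcons (rcons s b) c) -> coin_system (rcons s b).
Proof.
case/andP=> h so; apply/andP; split; first by case: s h so.
by move: so; rewrite -cats1 => /cat_sorted2[].
Qed.

Lemma coin_system_last2 s b c :
  coin_system (rcons (rcons s b) c) -> 0 < b < c.
Proof.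
move=> cs; have := @coin_gt0 _ (size s) (coin_system_belast cs).
rewrite size_rcons nth_rcons ltnn eqxx => -> //=.
case/andP: cs => _; rewrite -!cats1 -catA => /cat_sorted2[_] /=.
by rewrite andbT.
Qed.

Lemma one_point_canonical s b c m : coin_system (rcons (rcons s b) c) ->
  canonical (rcons s b) -> c <= m * b < c + b ->
  canonical (rcons (rcons s b) c) <->
  grd_size (rcons s b) (m * b - c) < m.
Proof.
move=> cs can /andP[cm mc]; have csb := coin_system_belast cs.
have /andP[b0 bc] := coin_system_last2 cs.
split=> [/(canonicalP cs) le | lt].
  (* The tuple tested is [m] copies of [b]; since [m * b - c < b < c], greedy pays the same amount
     with exactly one [c]. *)
  have sz : size (rcons (rcons (nseq (size s) 0) m) 0)
            = size (rcons (rcons s b) c) by rewrite !size_rcons size_nseq.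
  have := le _ sz; rewrite !rep_value_rcons ?size_rcons ?size_nseq //.
  have -> : rep_value s (nseq (size s) 0) = 0.
    by rewrite /rep_value big1 // => i _; rewrite nth_nseq ltn_ord.
  rewrite /rep_size !sumn_rcons sumn_nseq !mul0n add0n !addn0 -/(rep_size _).
  have {1}-> : m * b = 1 * c + (m * b - c) by lia.
  by rewrite grd_size_rcons //; lia.
have leG y : grd_size (rcons (rcons s b) c) y <= grd_size (rcons s b) y.
  elim/ltn_ind: y => y IH; case: (ltnP y c) => [yc|cy].
    by have := grd_size_rcons (rcons s b) 0 yc; rewrite !add0n => ->.
  have {1}-> : y = 1 * c + (y - c) by lia.
  rewrite grd_size_rconsD; last lia.
  have := IH (y - c); have := grd_size_subadditive y (m * b - c) csb can.
  have -> : y + (m * b - c) = m * b + (y - c) by lia.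
  by rewrite grd_size_rconsD //; lia.
(* The [n] coins [c] cancel on both sides; what remains uses only [rcons s b], where [leG] and [can]
   apply. *)
apply/(canonicalP cs) => a; case/lastP: a => [|a n]; rewrite !size_rcons //.
case=> sa; rewrite rep_value_rcons ?size_rcons // addnC.
rewrite grd_size_rconsD; last lia.
have /(canonicalP csb)/(_ a) := can; rewrite size_rcons => /(_ sa).
by have := leG (rep_value (rcons s b) a); rewrite /rep_size sumn_rcons; lia.
Qed.

Lemma ceil_multiple b c : 0 < b -> 0 < c -> exists k, k * b < c <= k.+1 * b.
Proof.
(* Dividing [c.-1] instead of [c] puts exact multiples at the upper, non-strict end. *)
move=> b0 c0; exists (c.-1 %/ b); have := divn_eq c.-1 b.
by have := ltn_pmod c.-1 b0; rewrite mulSn; lia.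
Qed.

Lemma grd_size1 x : grd_size [:: 1] x = x.
Proof. by rewrite /rep_size /= /rep_value big_ord0 subn0 divn1 addn0. Qed.

Lemma canonical2 a : coin_system [:: 1; a] -> canonical [:: 1; a].
Proof.
move=> cs; have can1 : canonical [:: 1].
  apply/canonicalP => // -[|n [|//]] // _.
  by rewrite grd_size1 /rep_value big_ord1 /rep_size /= muln1 addn0.
have h : a <= a * 1 < a + 1 by lia.
apply/(@one_point_canonical [::] 1 a a cs can1 h).
by rewrite muln1 subnn (grd_size1 0); case/andP: cs => _ /=; lia.
Qed.

Lemma grd_size_small a x : x < a -> grd_size [:: 1; a] x = x.
Proof.
by move=> xa; have := @grd_size_rcons [:: 1] a 0 x xa; rewrite grd_size1.
Qed.

Lemma canonical3 a b m : coin_system [:: 1; a; b] -> b <= m * a < b + a ->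
  canonical [:: 1; a; b] <-> m * a - b < m.
Proof.
move=> cs h; have ca := @canonical2 a (@coin_system_belast [:: 1] a b cs).
have ra : m * a - b < a by lia.
by rewrite -(grd_size_small ra); exact: (@one_point_canonical [:: 1] a b).
Qed.

(** The three bounds are the greedy condition, so explicit coefficients give the greedy size at
    once. *)
Lemma grd_size4 a b c n1 n2 n3 n4 :
  n1 < a -> n2 * a + n1 < b -> n3 * b + (n2 * a + n1) < c ->
  grd_size [:: 1; a; b; c] (n4 * c + (n3 * b + (n2 * a + n1))) =
  n1 + n2 + n3 + n4.
Proof.
move=> h1 h2 h3.
rewrite (@grd_size_rcons [:: 1; a; b]) // (@grd_size_rcons [:: 1; a]) //.
by rewrite (@grd_size_rcons [:: 1]) // grd_size1; lia.
Qed.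

Lemma canonical4_le a b c n1 n2 n3 n4 : coin_system [:: 1; a; b; c] ->
  canonical [:: 1; a; b; c] ->
  grd_size [:: 1; a; b; c] (n4 * c + (n3 * b + (n2 * a + n1))) <=
  n1 + n2 + n3 + n4.
Proof.
move=> cs /(canonicalP cs)/(_ [:: n1; n2; n3; n4] erefl).
have -> : rep_value [:: 1; a; b; c] [:: n1; n2; n3; n4]
        = n4 * c + (n3 * b + (n2 * a + n1)).
  by rewrite !rep_value_cons /rep_value big_ord0; lia.
by move/leq_trans; apply; rewrite /rep_size /=; lia.
Qed.

(** The coin [c] may repair the failing amount of the prefix, so the cases depend on where [c] lies
    relative to the least multiple of [a] that reaches [b]. *)
Lemma canonical4_prefix a b c : coin_system [:: 1; a; b; c] ->
  canonical [:: 1; a; b; c] -> canonical [:: 1; a; b].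
Proof.
move=> cs can; have csb := @coin_system_belast [:: 1; a] b c cs.
have /and4P[a1 ab bc _] : [&& 1 < a, a < b, b < c & true] by case/andP: cs.
have [k /andP[kb bk]] := @ceil_multiple a b (ltnW a1) (ltn_trans (ltnW a1) ab).
apply/(canonical3 (m := k.+1)) => //; first by lia.
rewrite ltnNge; apply/negP => kr.
have k1 : 0 < k by case: k bk {kb kr} => //; lia.
have le n1 n2 n3 n4 := canonical4_le n1 n2 n3 n4 cs can.
(* If [c] is too large to be used, greedy pays [k.+1 * a] with [b] and at least [k.+1] units, one
   coin too many. *)
case: (ltnP (k.+1 * a) c) => [kc|ck].
  have := le 0 k.+1 0 0.
  have -> : 0 * c + (0 * b + (k.+1 * a + 0))
          = 0 * c + (1 * b + (0 * a + (k.+1 * a - b))) by lia.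
  by rewrite grd_size4; lia.
(* Here [c <= k.+1 * a < b + a], so greedy pays [b + a] with [c] and at least one unit; two coins
   suffice, which forces exactly one unit. *)
have cE : c = (b + a).-1.
  have := le 0 1 1 0.
  have -> : 0 * c + (1 * b + (1 * a + 0))
          = 1 * c + (0 * b + (0 * a + (b + a - c))) by lia.
  by rewrite grd_size4; lia.
(* Now c = (k + 1) * a and b = k * a + 1, so 2 * b = c + (k - 1) * a + 2. *)
have := le 0 0 2 0.
case: k k1 kb bk kr ck => // k _ kb bk kr ck.
have -> : 0 * c + (2 * b + (0 * a + 0))
        = 1 * c + (0 * b + (k * a + 2)) by lia.
by rewrite grd_size4; lia.
Qed.

Theorem theorem6 (c2 c3 c4 : nat) (hc : coin_system [:: 1; c2; c3; c4]) :
  ~ canonical [:: 1; c2; c3; c4] <->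
  (~ canonical [:: 1; c2; c3] \/
   exists k : nat,
     k * c3 < c4 < k.+1 * c3 /\
     k.+1 < rep_size (GRD [:: 1; c2; c3; c4] (k.+1 * c3))).
Proof.
have /and4P[a1 ab bc _] : [&& 1 < c2, c2 < c3, c3 < c4 & true] by case/andP: hc.
have hc3 := @coin_system_belast [:: 1; c2] c3 c4 hc.
split=> [ncan | [ncan3 can | [k [_ lt]] can]]; last 2 first.
- exact/ncan3/(canonical4_prefix hc can).
- have := canonical4_le 0 0 k.+1 0 hc can.
  by rewrite mul0n !add0n !addn0 leqNgt lt.
have [j /andP[jb bj]] : exists j, j * c2 < c3 <= j.+1 * c2.
  by apply: ceil_multiple; lia.
have := @canonical3 c2 c3 j.+1 hc3; case=> [|to3 of3]; first by lia.
(* The numerical criterion decides canonicity of the prefix, so no excluded middle is needed. *)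
case: (ltnP (j.+1 * c2 - c3) j.+1) => [/of3 can3 | le]; last first.
  by left=> /to3; lia.
right; have [k /andP[kc ck]] : exists k, k * c3 < c4 <= k.+1 * c3.
  by apply: ceil_multiple; lia.
have kd : c4 <= k.+1 * c3 < c4 + c3 by lia.
have [_ of4] := @one_point_canonical [:: 1; c2] c3 c4 k.+1 hc can3 kd.
have ge : k < grd_size [:: 1; c2; c3] (k.+1 * c3 - c4).
  by rewrite ltnNge; apply/negP => h; apply/ncan/of4.
(* Equality would leave remainder 0, of greedy size 0, against [ge]. *)
have lt4 : c4 < k.+1 * c3.
  rewrite ltn_neqAle ck andbT; apply/eqP => e; move: ge.
  rewrite -e subnn (@grd_size_rcons [:: 1; c2] c3 0 0) ?grd_size_small; lia.
exists k; rewrite kc lt4; split=> //.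
have -> : k.+1 * c3 = 1 * c4 + (k.+1 * c3 - c4) by lia.
by rewrite (@grd_size_rcons [:: 1; c2; c3]); lia.
Qed.
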